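(* There exist a positive constant $b$ and an integer $r''$ such that for every $r\ge r''$ and every regular subgroup $R$ of $\mathrm{Sym}(r)$, the following holds. Let $\mathcal{T}(R)$ be the set of subsets $S\subseteq R$ such that $\mathrm{Aut}(\Gamma(R,S))>R$ and there exists $G\le\mathrm{Aut}(\Gamma(R,S))$ with (i) $R$ maximal in $G$ and $|G_1|>2^{r^{0.499}}$; (ii) $|G_R|\le 4\log_2 r$; (iii) some $G_R$-orbit on the vertex set not fixed setwise by $G_1$. Let $\mathcal{T}'(R)$ be the set of $S\in\mathcal{T}(R)$ for which such a $G$ can be chosen to satisfy additionally (iv) $G_R=1$. Then $|\mathcal{T}(R)\setminus\mathcal{T}'(R)|\le 2^{\,r-b r^{0.499}/(4(\log_2 r)^3)+1}$.
   Context: A regular subgroup $R$ of $\mathrm{Sym}(r)$ is identified with the right regular representation of the abstract group $R$ on itself. For $S\subseteq R$, the Cayley digraph $\Gamma(R,S)$ has vertex set $R$ and $(g,h)$ is an arc iff $hg^{-1}\in S$; $R\le\mathrm{Aut}(\Gamma(R,S))$. $G_1$ denotes the stabiliser in $G$ of the vertex $1$; $G_R=\bigcap_{g\in G}R^g$ is the core of $R$ in $G$. *)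

(* Defs.v *)
From HB Require Import structures.
From mathcomp Require Import all_boot all_order all_algebra all_fingroup all_solvable.
From mathcomp Require Import reals exp.

Set Implicit Arguments.
Unset Strict Implicit.
Unset Printing Implicit Defensive.

Import Order.TTheory GRing.Theory Num.Theory GroupScope.

Local Open Scope ring_scope.

Definition regular_perm (T : finType) (A : {set {perm T}}) : bool :=
  [transitive A, on [set: T] | 'P] && [forall x : T, 'C_A[x | 'P] == 1%g].

Definition log2 (K : realType) (x : K) : K := ln x / ln 2.

(* For a finite group gT, the subgroup of Sym(gT) formed by the right
   translations g |-> g * x. *)
Definition rreg (gT : finGroupType) : {group {perm gT}} :=
  (actperm 'R @* [set: gT])%G.

Definition cayley (gT : finGroupType) (S : {set gT}) : rel gT :=
  [rel g h | (h * g^-1)%g \in S].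

Definition digraph_aut_set (T : finType) (e : rel T) : {set {perm T}} :=
  [set s : {perm T} | [forall x, forall y, e (s x) (s y) == e x y]].

Lemma digraph_aut_group_set (T : finType) (e : rel T) :
  group_set (digraph_aut_set e).
Proof.
apply/group_setP; split=> [|s t].
  by rewrite inE; apply/forallP=> x; apply/forallP=> y; rewrite !perm1.
rewrite !inE => /forallP es /forallP et.
apply/forallP=> x; apply/forallP=> y; rewrite !permM.
by rewrite (eqP (forallP (et _) _)) (eqP (forallP (es _) _)).
Qed.

Definition digraph_aut (T : finType) (e : rel T) : {group {perm T}} :=
  Group (digraph_aut_group_set e).

Section Families.
Variables (K : realType) (gT : finGroupType).

Let r : K := #|gT|%:R.

Definition cond_i (G : {group {perm gT}}) : bool :=
  maximal (rreg gT) G &&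
  (2 `^ (r `^ (499 / 1000)) < #|'C_G[1%g | 'P]|%:R).

Definition cond_ii (G : {group {perm gT}}) : bool :=
  #|gcore (rreg gT) G|%:R <= 4 * log2 r.

Definition cond_iii (G : {group {perm gT}}) : bool :=
  [exists v : gT,
    ~~ [acts 'C_G[1%g | 'P], on orbit 'P (gcore (rreg gT) G) v | 'P]].

Definition cond_iv (G : {group {perm gT}}) : bool :=
  gcore (rreg gT) G == 1%g.

Definition calT : {set {set gT}} :=
  [set S : {set gT} | (rreg gT \proper digraph_aut (cayley S)) &&
    [exists G : {group {perm gT}},
      [&& G \subset digraph_aut (cayley S),
          cond_i G, cond_ii G & cond_iii G]]].

Definition calT' : {set {set gT}} :=
  [set S in calT |
    [exists G : {group {perm gT}},
      [&& G \subset digraph_aut (cayley S),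
          cond_i G, cond_ii G, cond_iii G & cond_iv G]]].

End Families.

(* Main.v *)
(* The condition |G_1| > 2^(r^0.499) alone makes S rare. Put
   k = floor (r^0.499 / (3 log2 r)) and fix a set U of 3k vertices. As
   r^(3k) <= 2^(r^0.499), two automorphisms of Gamma(R,S) agree on U, so some
   automorphism fixes U pointwise and moves a vertex v to wv with w <> 1. Then v
   and wv have the same in-neighbours in U, that is, x and wx are both in S or
   both outside S for every x in v U^-1. For given v and w at most 2^(r-k)
   subsets S satisfy this, hence at most r^2 2^(r-k) subsets in total. *)
Require Import Defs.
From HB Require Import structures.
From mathcomp Require Import all_boot all_order all_algebra all_fingroup all_solvable.
From mathcomp Require Import reals exp ring lra.

Set Implicit Arguments.
Unset Strict Implicit.
Unset Printing Implicit Defensive.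

Import Order.TTheory GRing.Theory Num.Theory GroupScope.

Local Open Scope ring_scope.

(* A maximal Y in X with Y disjoint from wY satisfies X <= Y + wY + w^-1 Y; the
   sets S are then determined by their trace outside wY. *)
Lemma card_shift_invariant_on (gT : finGroupType) (w : gT) (X : {set gT})
    (k : nat) :
  w != 1%g -> (3 * k <= #|X|)%N ->
  (#|[set S : {set gT} | [forall x in X, (x \in S) == ((w * x)%g \in S)]]|
     <= 2 ^ (#|gT| - k))%N.
Proof.
move=> w1 leX.
pose P (Y : {set gT}) := (Y \subset X) && [disjoint Y & (w *: Y)%g].
have P0 : P set0 by rewrite /P sub0set -setI_eq0 set0I eqxx.
have [Y maxY _] := maxset_exists P0.
have /andP[sYX dYw] := maxsetp maxY.
have nYw y : y \in Y -> (w * y)%g \notin Y.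
  by move=> yY; rewrite (disjointFl dYw) // mem_lcoset mulKg.
have cover : X \subset Y :|: ((w *: Y) :|: (w^-1 *: Y))%g.
  apply/subsetP=> x xX; apply/negPn/negP.
  rewrite !inE !mem_lcoset invgK !negb_or => /and3P[xY wVx wx].
  case/negP: xY.
  (* Maximality is contradicted by adding [x]: the new overlaps with the translate would be
     [x = w * x], excluded by [w != 1], or [x] in [w *: Y], or [w * x] in [Y]. *)
  suff PxY : P (x |: Y) by rewrite -(maxsetsup maxY PxY (subsetUr _ _)) setU11.
  rewrite /P subUset sub1set xX sYX /= -setI_eq0 -subset0.
  apply/subsetP=> y; rewrite !inE mem_lcoset => /andP[].
  case/predU1P=> [->|yY]; rewrite !inE.
    case/orP=> [|]; last by rewrite (negPf wVx).
    by rewrite -{2}[x]mul1g (can_eq (mulgK x)) eq_invg1 (negPf w1).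
  case/predU1P=> [wVy|wVy].
    by rewrite -wVy mulKVg yY in wx.
  by move: (nYw _ wVy); rewrite mulKVg yY.
have lekY : (k <= #|Y|)%N.
  rewrite -(leq_pmul2l (isT : (0 < 3)%N)); apply: leq_trans leX _.
  apply: leq_trans (subset_leq_card cover) _.
  apply: leq_trans (leq_card_setU _ _).1 _.
  have := (leq_card_setU (w *: Y)%g (w^-1 *: Y)%g).1; rewrite !card_lcoset => le2.
  by rewrite 2!mulSn mul1n leq_add2l.
set F := [set S | _].
have injF : {in F &, injective (fun S => S :\: (w *: Y)%g)}.
  move=> S T; rewrite !inE => /forall_inP hS /forall_inP hT /setP eST.
  have out x : x \notin (w *: Y)%g -> (x \in S) = (x \in T).
    by move=> nx; have := eST x; rewrite !inE nx.
  apply/setP=> x; have [|/out//] := boolP (x \in (w *: Y)%g).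
  (* Membership of [w * y] equals that of [y], since [y] is in [X]; and [y] lies outside [w *: Y] by
     disjointness, where the traces agree. *)
  case/lcosetP=> y yY ->; have yX := subsetP sYX _ yY.
  by rewrite -(eqP (hS _ yX)) -(eqP (hT _ yX)) out // (disjointFr dYw).
rewrite -(card_in_imset injF).
apply: (@leq_trans #|powerset (~: (w *: Y)%g)|).
  apply/subset_leq_card/subsetP=> _ /imsetP[S _ ->].
  by rewrite powersetE setDE subsetIr.
by rewrite card_powerset leq_exp2l // cardsCs setCK card_lcoset leq_sub2l.
Qed.

(** Pigeonhole: there are [#|T| ^ #|U|] maps from [U] to [T], so two distinct elements of [G] have
    the same restriction to [U], and their quotient is the required [s]. *)
Lemma perm_group_fixing_nontrivial (T : finType) (G : {group {perm T}})
    (U : {set T}) :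
  (#|T| ^ #|U| < #|G|)%N -> exists2 s, s \in 'C_G(U | 'P) & s != 1%g.
Proof.
move=> ltG.
pose h (s : {perm T}) := [ffun x : {x | x \in U} => s (val x)].
have /injectivePn : ~~ injectiveb (fun s : subg_of G => h (sgval s)).
  apply: contraL ltG => /injectiveP /leq_card.
  by rewrite card_ffun card_sig -leqNgt card_sub; apply.
case=> s [t nst /ffunP est].
exists (sgval s * (sgval t)^-1)%g.
  rewrite inE groupM ?groupV ?subgP //=; apply/astabP=> x xU.
  have := est (exist _ x xU); rewrite !ffunE /= /aperm permM => ->.
  by rewrite permK.
by rewrite -eq_mulgV1; apply: contraNneq nst => /val_inj->.
Qed.

Lemma card_large_digraph_aut (gT : finGroupType) (k : nat) :
  (3 * k <= #|gT|)%N ->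
  (#|[set S : {set gT} | #|gT| ^ (3 * k) < #|digraph_aut (cayley S)|]|
     <= #|gT| ^ 2 * 2 ^ (#|gT| - k))%N.
Proof.
move=> le3k.
have [U _ cardU] : exists2 U : {set gT}, U \subset [set: gT] & #|U| = (3 * k)%N.
  have : (0 < #|[set A : {set gT} | A \subset [set: gT] & #|A| == (3 * k)%N]|)%N.
    by rewrite cards_draws cardsT bin_gt0.
  by case/card_gt0P=> U; rewrite inE => /andP[sU /eqP cU]; exists U.
(* As [U] does not depend on [S], neither does [X v]; a union bound over the pairs (v, w) is
   therefore enough. *)
pose X (v : gT) := [set v * u^-1 | u in U]%g.
have cardX v : #|X v| = (3 * k)%N.
  by rewrite card_imset // => x y /mulgI/invg_inj.
(* For w = 1 every [S] would satisfy the condition, so these pairs get the empty set; the pair built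
   below has w different from 1 because [s] moves [v]. *)
pose C (p : gT * gT) : {set {set gT}} :=
  if p.2 == 1%g then set0 else
  [set S : {set gT} | [forall x in X p.1, (x \in S) == ((p.2 * x)%g \in S)]].
apply: (@leq_trans #|\bigcup_p C p|).
  apply/subset_leq_card/subsetP=> S; rewrite inE -cardU.
  case/perm_group_fixing_nontrivial=> s /setIP[sA /astabP sU] s1.
  have [v sv] : exists v, s v != v.
    apply/existsP; apply: contraR s1; rewrite negb_exists => /forallP sE.
    by apply/eqP/permP=> v; rewrite perm1; apply/eqP; rewrite -[_ == _]negbK.
  apply/bigcupP; exists (v, (s v * v^-1)%g) => //.
  rewrite /C /= -eq_mulgV1 (negPf sv) inE.
  apply/forall_inP=> _ /imsetP[u uU ->].
  move: sA; rewrite inE => /forallP/(_ u)/forallP/(_ v).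
  have := sU u uU; rewrite /= /aperm => ->.
  by rewrite /cayley /= mulgA mulgKV eq_sym.
apply: (@leq_trans (\sum_(p : gT * gT) 2 ^ (#|gT| - k))%N).
  apply: (big_ind2 (fun (A : {set {set gT}}) n => #|A| <= n)%N).
  - by rewrite cards0.
  - move=> A m B n leA leB; apply: leq_trans (leq_card_setU _ _).1 _.
    exact: leq_add.
  - move=> p _; rewrite /C; case: eqP => [|/eqP w1]; first by rewrite cards0.
    by apply: card_shift_invariant_on; rewrite ?cardX.
by rewrite sum_nat_const card_prod expnS expn1.
Qed.

Lemma card_regular_perm (T : finType) (A : {group {perm T}}) (x : T) :
  regular_perm A -> #|A| = #|T|.
Proof.
case/andP=> /atransP/(_ x (in_setT x)) orbA /forallP/(_ x) /eqP stabA.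
by rewrite -(card_orbit_stab 'P A x) stabA cards1 muln1 orbA cardsT.
Qed.

Lemma powR_log2 (K : realType) (x : K) : 0 < x -> 2 `^ log2 x = x.
Proof.
move=> x_gt0; have ln2 : ln (2 : K) != 0 by rewrite gt_eqF // ln_gt0 // ltr1n.
by rewrite /log2 /powR pnatr_eq0 /= mulfVK // lnK.
Qed.

Lemma log2_ge1 (K : realType) (x : K) : 2 <= x -> 1 <= log2 x.
Proof.
move=> x_ge2; rewrite /log2 ler_pdivlMr ?ln_gt0 ?ltr1n // mul1r.
by rewrite ler_ln // posrE; lra.
Qed.

(** Applying ln y < y to y = x^(1/10) gives ln x <= 10 x^(1/10); the factor 20 then comes from ln 2
    >= 1/2. *)
Lemma log2_le_powR (K : realType) (x : K) : 1 <= x -> log2 x <= 20 * x `^ 10^-1.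
Proof.
move=> x_ge1; have x_gt0 : 0 < x by lra.
have ln2 : 2^-1 <= ln (2 : K).
  have := @le_ln1Dx K (- 2^-1) ltac:(lra).
  rewrite (_ : 1 + - 2^-1 = 2^-1); last by lra.
  by rewrite lnV ?posrE //; lra.
have lnx : ln x <= 10 * x `^ 10^-1.
  have := ltW (ln_sublinear (powR_gt0 10^-1 x_gt0)).
  by rewrite ln_powR; lra.
have y0 : 0 < x `^ 10^-1 by rewrite powR_gt0.
by rewrite /log2 ler_pdivrMr; nra.
Qed.

(** Squaring the previous bound gives 24 (log2 x)^2 <= 9600 x^(1/5). The threshold makes 9600 <=
    x^(1/5), and x^(2/5) <= x^0.499. *)
Lemma sqr_log2_le_powR (K : realType) (x : K) :
  9600 ^+ 5 <= x -> 24 * log2 x ^+ 2 <= x `^ (499 / 1000).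
Proof.
move=> x_ge; have x_ge1 : 1 <= x by apply: le_trans x_ge; rewrite exprn_ege1 //; lra.
have L0 : 0 <= log2 x by rewrite divr_ge0 // ln_ge0 // ler1n.
have y_ge : 9600 <= x `^ 5^-1.
  have -> : 9600 = (9600 ^+ 5) `^ 5^-1 :> K.
    by rewrite -powR_mulrn ?ler0n // -powRrM divff ?pnatr_eq0 // powRr1 ?ler0n.
  by apply: ge0_ler_powR; rewrite ?nnegrE ?invr_ge0 ?exprn_ge0 ?ler0n //; lra.
clear x_ge; have yy : x `^ 10^-1 * x `^ 10^-1 = x `^ 5^-1.
  by rewrite -powRD; [congr (_ `^ _); lra | apply/implyP => _; rewrite gt_eqF; lra].
have yyy : x `^ 5^-1 * x `^ 5^-1 <= x `^ (499 / 1000).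
  rewrite -powRD; last by apply/implyP => _; rewrite gt_eqF; lra.
  by apply: ler_powR => //; lra.
have := log2_le_powR x_ge1; move: L0; rewrite expr2.
set L := log2 x => L0 leL.
have : L * L <= (20 * x `^ 10^-1) * (20 * x `^ 10^-1) by rewrite ler_pM.
nra.
Qed.

(** This compares the final exponents, with L = log2 r, a = r^0.499 and k the floor of q = a / (3L).
    Here a / (4L^3) <= a / (4L) = 3q/4, and 24 L^2 <= a gives 2L <= q/4; the sum is at most q < k +
    1. *)
Lemma exponent_le (K : realFieldType) (L a k : K) :
  1 <= L -> 24 * L ^+ 2 <= a -> a / (3 * L) < k + 1 ->
  L * 2 - k <= 1 - a / (4 * L ^+ 3).
Proof.
move=> L_ge1 leL ltk; have L_gt0 : 0 < L by lra.
have le_b : a / (4 * L ^+ 3) <= a / (4 * L).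
  rewrite ler_wpM2l //; first by apply: le_trans leL; rewrite mulr_ge0 ?sqr_ge0.
  rewrite lef_pV2 ?posrE ?mulr_gt0 ?exprn_gt0 //.
  by rewrite ler_pM2l // -[leLHS]expr1 ler_weXn2l.
have bE : a / (4 * L) = 3 / 4 * (a / (3 * L)) by field; lra.
have le_q : 8 * L <= a / (3 * L) by rewrite ler_pdivlMr; nra.
rewrite bE in le_b.
by move: (a / _) (a / _) ltk le_b le_q => q c; lra.
Qed.

(** Writing r = 2^(log2 r) turns the hypothesis into r^k <= 2^(r^0.499) < |G_1|, and G_1 lies in the
    automorphism group. *)
Lemma calT_large_digraph_aut (K : realType) (gT : finGroupType) (k : nat) :
  (1 < #|gT|)%N ->
  log2 #|gT|%:R * k%:R <= #|gT|%:R `^ (499 / 1000) :> K ->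
  calT K gT \subset
    [set S : {set gT} | (#|gT| ^ k < #|digraph_aut (cayley S)|)%N].
Proof.
move=> r_gt1 le_k; apply/subsetP=> S; rewrite !inE => /andP[_ /existsP[G]].
case/and4P=> sGA /andP[_ ltG] _ _; rewrite -(ltr_nat K).
have -> : (#|gT| ^ k)%:R = 2 `^ (log2 #|gT|%:R * k%:R) :> K.
  by rewrite powRrM powR_log2 ?ltr0n 1?ltnW // powR_mulrn // natrX.
apply: (le_lt_trans (ler_powR _ le_k)); first by rewrite ler1n.
apply: (lt_le_trans ltG); rewrite ler_nat subset_leq_card //.
by rewrite subIset ?sGA.
Qed.

Theorem theorem6p2 (K : realType) :
  exists (b : K) (r'' : nat), 0 < b /\
    forall (r : nat) (R : {group {perm 'I_r}}),
      (r'' <= r)%N -> regular_perm R ->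
      #|calT K (subg_of R) :\: calT' K (subg_of R)|%:R
        <= 2 `^ (r%:R - b * r%:R `^ (499 / 1000) / (4 * log2 r%:R ^+ 3) + 1).
Proof.
(* The constant b = 1 suffices; the bound on r is the threshold of [sqr_log2_le_powR]. *)
exists 1, (Num.bound (9600 ^+ 5 : K)); split=> // r R le_r regR.
have r_ge : 9600 ^+ 5 <= r%:R :> K.
  apply: ltW; apply: lt_le_trans (archi_boundP _) _; first by rewrite exprn_ge0.
  by rewrite ler_nat.
have r_ge2 : 2 <= r%:R :> K.
  by apply: le_trans r_ge; rewrite exprS; have := @exprn_ege1 K 4 9600; lra.
have r_gt1 : (1 < r)%N by rewrite -(ler_nat K).
have cardR : #|{: subg_of R}| = r.
  by rewrite card_sub (card_regular_perm (Ordinal r_gt1) regR) card_ord.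
have leL := sqr_log2_le_powR r_ge.
have L_ge1 := log2_ge1 r_ge2.
clear r_ge; have a_le : r%:R `^ (499 / 1000) <= r%:R :> K.
  by rewrite -[leRHS]powRr1 ?ler_powR //; lra.
have large k := @calT_large_digraph_aut K (subg_of R) k.
have count k := @card_large_digraph_aut (subg_of R) k.
rewrite cardR in large count.
move: leL L_ge1 a_le large; set L := log2 _; set a := _ `^ (499 / 1000).
move=> leL L_ge1 a_le large; have L_gt0 : 0 < L by lra.
have q_ge0 : 0 <= a / (3 * L) by rewrite divr_ge0 ?powR_ge0 //; lra.
set q := a / (3 * L) in q_ge0.
have aE : a = 3 * L * q by rewrite /q mulrC mulfVK // mulf_neq0 // gt_eqF.
have /andP[k_le k_gt] := truncn_itv q_ge0.
set k := Num.truncn q in k_le k_gt; rewrite -natr1 in k_gt.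
(* Room for 3k vertices: 3k <= 3q <= 3Lq = a <= r, using L >= 1. *)
have k_r : (3 * k <= r)%N by rewrite -(ler_nat K) natrM; nra.
have le_k : L * (3 * k)%:R <= a by rewrite natrM; nra.
have leT : (#|calT K (subg_of R)| <= r ^ 2 * 2 ^ (r - k))%N.
  exact: leq_trans (subset_leq_card (large _ r_gt1 le_k)) (count _ k_r).
apply: (@le_trans _ _ (r ^ 2 * 2 ^ (r - k))%:R).
  by rewrite ler_nat (leq_trans _ leT) // subset_leq_card // subsetDl.
rewrite natrM !natrX -(powR_mulrn 2) // -(powR_mulrn _ (ler0n _ 2)).
(* With r = 2^L the bound becomes the single power 2^(2L + r - k), so only exponents remain to be
   compared. *)
rewrite -{1}[r%:R](@powR_log2 K); last by lra.
rewrite -powRrM -powRD ?pnatr_eq0 ?implybT //.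
apply: ler_powR; first by rewrite ler1n.
rewrite natrB ?(leq_trans _ k_r) ?leq_pmull // mul1r -/L.
have := exponent_le L_ge1 leL k_gt; rewrite -/a.
by move: (a / (4 * L ^+ 3)) => c; clear; lra.
Qed.
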